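(* Let $\mathcal W\subseteq\{0,1\}^{n_\xi}$ and $\mathcal Y\subseteq\{0,1\}^{n_y}$ be nonempty, let $\mathcal U\subset\mathbb R^{n_\xi}$ be a nonempty compact polyhedron, and let $C\in\mathbb R^{n_\xi\times n_\xi}$, $P\in\mathbb R^{n_\xi\times n_y}$. For $w\in\mathcal W$ and $\bar\xi\in\mathcal U$ let $$\mathcal U(w,\bar\xi)=\{\xi\in\mathcal U:\ w_i\xi_i=w_i\bar\xi_i,\ i=1,\ldots,n_\xi\}.$$ Then at most $k=n_\xi+1$ second-stage policies are needed to obtain an optimal solution of the robust optimization problem with decision-dependent information discovery; that is, for $k=n_\xi+1$, a decision $w\in\mathcal W$ is optimal for $$\min_{\substack{w\in\mathcal W\\ y^1,\ldots,y^k\in\mathcal Y}}\ \max_{\bar\xi\in\mathcal U}\ \min_{i=1,\ldots,k}\ \max_{\xi\in\mathcal U(w,\bar\xi)}\ \xi^\top Cw+\xi^\top Py^i$$ if and only if it is optimal for $$\min_{w\in\mathcal W}\ \max_{\bar\xi\in\mathcal U}\ \min_{y\in\mathcal Y}\ \max_{\xi\in\mathcal U(w,\bar\xi)}\ \xi^\top Cw+\xi^\top Py .$$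
   Context: A decision $w\in\mathcal W$ is called optimal for one of the two problems if it attains the outer minimum over $\mathcal W$ (in the first problem, together with a suitable choice of $y^1,\ldots,y^k\in\mathcal Y$, which need not be distinct). *)

(* Defs.v *)
From HB Require Import structures.
From mathcomp Require Import all_boot all_order all_algebra.
From mathcomp Require Import all_classical all_reals all_analysis.

Set Implicit Arguments.
Unset Strict Implicit.
Unset Printing Implicit Defensive.

Import Order.TTheory GRing.Theory Num.Theory.
Import numFieldNormedType.Exports.

Local Open Scope classical_set_scope.
Local Open Scope ring_scope.

(* Vectors of {0,1}^n are boolean column vectors, so a set of decisions or
   policies is a finite set and minima over it are attained. *)
Definition realvec (R : realType) (n : nat) (v : 'cV[bool]_n) : 'cV[R]_n :=
  map_mx (fun b : bool => b%:R) v.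

Definition polyhedron (R : realType) (n : nat) (U : set 'cV[R]_n) : Prop :=
  exists (m : nat) (A : 'M[R]_(m, n)) (b : 'cV[R]_m),
    U = [set x | forall i : 'I_m, (A *m x) i 0 <= b i 0].

Section DDID.

Variables (R : realType) (nxi ny : nat).
Variables (W : {set 'cV[bool]_nxi}) (Y : {set 'cV[bool]_ny}).
Variables (U : set 'cV[R]_nxi) (C : 'M[R]_nxi) (P : 'M[R]_(nxi, ny)).

Definition posterior (w : 'cV[bool]_nxi) (xibar : 'cV[R]_nxi) :
    set 'cV[R]_nxi :=
  [set xi | U xi /\
    forall i, realvec R w i 0 * xi i 0 = realvec R w i 0 * xibar i 0].

Definition cost (w : 'cV[bool]_nxi) (y : 'cV[bool]_ny) (xi : 'cV[R]_nxi) : R :=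
  (xi^T *m C *m realvec R w) 0 0 + (xi^T *m P *m realvec R y) 0 0.

(* Maxima over sets of scenarios are suprema in the extended reals; when U is a
   nonempty compact polyhedron they are finite and attained. *)
Definition worst_cost (w : 'cV[bool]_nxi) (xibar : 'cV[R]_nxi)
    (y : 'cV[bool]_ny) : \bar R :=
  ereal_sup [set (cost w y xi)%:E | xi in posterior w xibar].

Definition adaptive_value (w : 'cV[bool]_nxi) : \bar R :=
  ereal_sup
    [set \big[Order.min/+oo%E]_(y in Y) worst_cost w xibar y | xibar in U].

Definition kadapt_value (k : nat) (w : 'cV[bool]_nxi)
    (y : 'I_k -> 'cV[bool]_ny) : \bar R :=
  ereal_sup
    [set \big[Order.min/+oo%E]_(i < k) worst_cost w xibar (y i) | xibar in U].

Definition optimal (w : 'cV[bool]_nxi) : Prop :=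
  w \in W /\
  forall w', w' \in W -> (adaptive_value w <= adaptive_value w')%E.

Definition kadapt_optimal (k : nat) (w : 'cV[bool]_nxi) : Prop :=
  w \in W /\
  exists y : 'I_k -> 'cV[bool]_ny,
    (forall i, y i \in Y) /\
    forall (w' : 'cV[bool]_nxi) (y' : 'I_k -> 'cV[bool]_ny),
      w' \in W -> (forall i, y' i \in Y) ->
      (kadapt_value w y <= kadapt_value w' y')%E.

End DDID.

(* Main.v *)
(** Fix [w] and let [theta] be the value of the fully adaptive problem at [w].
For each policy [y], the scenarios [xibar] in [U] whose posterior worst-case
cost under [y] exceeds [theta] form a convex set, since some [xi] in the
posterior witnesses the excess and [U], the posterior constraints and the cost
are all compatible with convex combinations of the pairs [(xibar, xi)]. By
definition of [theta] these sets have no common point, so by Helly's theorem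
some [nxi + 1] of them have none either, and the corresponding policies already
guarantee the value [theta]. *)
Require Import Defs.
From HB Require Import structures.
From mathcomp Require Import all_boot all_order all_algebra.
From mathcomp Require Import all_classical all_reals all_analysis.

Set Implicit Arguments.
Unset Strict Implicit.
Unset Printing Implicit Defensive.

Import Order.TTheory GRing.Theory Num.Theory.
Import numFieldNormedType.Exports.

Lemma convex_setP (R : numFieldType) (E : lmodType R)
    (A : set (convex_lmodType E)) :
  convex_set A <->
  (forall (x y : E) (a b : R), A x -> A y -> (0 < a)%R -> (0 < b)%R ->
     (a + b = 1)%R -> A (a *: x + b *: y)%R).
Proof.
split=> [cA x y a b Ax Ay a0 b0 ab1|cA].
- have a1 : (a <= 1)%R by rewrite -ab1 lerDl ltW.
  have := cA x y (Itv01 (ltW a0) a1); rewrite !inE => /(_ Ax Ay).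
  by have -> : (b = 1 - a)%R by rewrite -ab1 addrAC subrr add0r.
- apply/convex_setW => x y; rewrite !inE => Ax Ay k k0 k1.
  rewrite inE; apply: (cA x y k%:num%R (1 - k%:num)%R) => //.
  + by rewrite subr_gt0.
  + by rewrite addrC subrK.
Qed.

(** Weights are left unnormalised so that each sign half of an affine dependence can be fed in
    directly. *)
Lemma convex_set_sum (R : realFieldType) (E : lmodType R)
    (A : set (convex_lmodType E)) (I : finType) (P : pred I)
    (c : I -> R) (x : I -> E) :
  convex_set A ->
  (forall i, P i -> (0 < c i)%R) -> (forall i, P i -> A (x i)) ->
  (0 < \sum_(i | P i) c i)%R ->
  A ((\sum_(i | P i) c i)^-1 *: \sum_(i | P i) c i *: x i)%R.
Proof.
move=> /convex_setP cA c_gt0 Ax.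
(* An invariant of pairs (total weight, weighted sum) that addition preserves; the zero alternative
   covers the empty sum, which cannot be normalised. *)
pose K (a : R) (v : E) :=
  (a = 0 /\ v = 0)%R \/ (0 < a)%R /\ A (a^-1 *: v)%R.
have : K (\sum_(i | P i) c i)%R (\sum_(i | P i) c i *: x i)%R.
  apply: (big_ind2 K); first by left.
  - move=> a v b u [[-> ->]|[a0 Aa]] [[-> ->]|[b0 Ab]]; rewrite ?add0r ?addr0.
    + by left.
    + by right.
    + by right.
    + right; split; first exact: addr_gt0.
      have ab0 : (a + b != 0)%R by rewrite gt_eqF ?addr_gt0.
      have := cA _ _ (a / (a + b))%R (b / (a + b))%R Aa Ab.
      rewrite !divr_gt0 ?addr_gt0 // -mulrDl divff // => /(_ isT isT erefl).
      rewrite !scalerA (mulrAC a) (mulrAC b) !divff ?gt_eqF // !mul1r.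
      by rewrite -scalerDr.
  - move=> i Pi; right; split; first exact: c_gt0.
    by rewrite scalerA mulVf ?scale1r ?gt_eqF ?c_gt0 //; exact: Ax.
by case=> [[-> _]|[_]//]; rewrite ltxx.
Qed.

(** Appending a coordinate 1 to each point gives [m] rows of length [n + 1 < m]; a nonzero vector of
    the left kernel is the dependence. *)
Lemma affine_dependence (F : fieldType) (n m : nat) (x : 'I_m -> 'cV[F]_n) :
  (n.+1 < m)%N ->
  exists c : 'I_m -> F,
    [/\ exists i, (c i != 0)%R, (\sum_i c i = 0)%R & (\sum_i c i *: x i = 0)%R].
Proof.
move=> n1m.
pose M : 'M[F]_(m, n + 1) := row_mx (\matrix_(i, j) x i j 0%R) (const_mx 1%R).
have : (kermx M != 0)%R.
  rewrite kermx_eq0 -row_leq_rank -ltnNge.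
  by rewrite (leq_ltn_trans (rank_leq_col _)) // addn1.
move=> /rowV0Pn[u /sub_kermxP uM /rV0Pn[i0 ui0]]; move: uM.
rewrite mul_mx_row => /(congr1 (fun v => (lsubmx v, rsubmx v))).
rewrite row_mxKl row_mxKr !linear0 => -[xE cE].
exists (u 0%R); split; first by exists i0.
- have /matrixP/(_ 0%R 0%R) := cE.
  rewrite !mxE => sum0; rewrite -[RHS]sum0.
  by apply: eq_bigr => i _; rewrite !mxE mulr1.
- apply/matrixP => j l; rewrite ord1.
  have /matrixP/(_ 0%R j) := xE.
  rewrite !mxE summxE => sum0; rewrite -[RHS]sum0.
  by apply: eq_bigr => i _; rewrite !mxE.
Qed.

Lemma sum_sign (R : realDomainType) (V : zmodType) (I : finType)
    (c : I -> R) (G : I -> V) :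
  (forall i, c i = 0 -> G i = 0)%R ->
  (\sum_i G i = \sum_(i | 0 < c i) G i + \sum_(i | c i < 0) G i)%R.
Proof.
move=> G0; rewrite (bigID (fun i => (0 < c i)%R)) /=; congr (_ + _)%R.
rewrite (bigID (fun i => (c i < 0)%R)) /= [X in (_ + X)%R]big1 ?addr0.
  by apply: eq_bigl => i; case: ltgtP.
by move=> i; case: ltgtP => // ci _; exact: G0.
Qed.

(** Helly's theorem, by induction on the number of sets through Radon points. Subfamilies are maps
    [f], so repetitions are allowed and small families are covered. *)
Lemma helly (R : realFieldType) (n m : nat)
    (F : 'I_m -> set (convex_lmodType 'cV[R]_n)) :
  (forall i, convex_set (F i)) ->
  (forall f : 'I_n.+1 -> 'I_m, exists x, forall i, F (f i) x) ->
  exists x, forall i, F i x.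
Proof.
elim: m F => [|m IHm] F cF HF; first by exists 0%R => -[].
have [mn|nm] := leqP m n.
  (* With at most [n + 1] sets, [inord] reaches every index: one subfamily is the whole family. *)
  have [x Fx] := HF (fun i => inord i).
  exists x => i; have in1 : (i < n.+1)%N by rewrite (leq_trans (ltn_ord i)).
  by have := Fx (Ordinal in1); rewrite /= inord_val.
(* By induction, [x i] lies in every set except possibly [F i]. *)
have /choice[x Fx] i : exists x, forall j, F (lift i j) x.
  by apply: IHm => [j|f]; [exact: cF|exact: (HF (lift i \o f))].
have [c [[i0 ci0] c0 cx0]] := affine_dependence x (nm : (n.+1 < m.+1)%N).
have Fne i j : i != j -> F j (x i).
  by move=> ij; case: (unliftP i j) ij => [k ->|->]; rewrite ?eqxx.
pose s := (\sum_(i | 0 < c i) c i)%R.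
have sN : (s = \sum_(i | c i < 0) - c i)%R.
  by rewrite sumrN; apply/eqP; rewrite -addr_eq0 -sum_sign ?c0.
have s_gt0 : (0 < s)%R.
  (* Whichever sign [c i0] has, one of the two expressions for [s] contains a positive term. *)
  have := ci0; rewrite neq_lt => /orP[ci|ci].
    rewrite sN (bigD1 i0) //= ltr_pwDl ?oppr_gt0 //.
    by apply: sumr_ge0 => i /andP[? _]; rewrite oppr_ge0 ltW.
  rewrite /s (bigD1 i0) //= ltr_pwDl //.
  by apply: sumr_ge0 => i /andP[? _]; rewrite ltW.
pose p := (s^-1 *: \sum_(i | 0 < c i) c i *: x i)%R.
have pN : (p = s^-1 *: \sum_(i | c i < 0) - c i *: x i)%R.
  congr (_ *: _)%R; under [RHS]eq_bigr do rewrite scaleNr.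
  rewrite sumrN; apply/eqP; rewrite -addr_eq0 -sum_sign ?cx0 // => i ->.
  by rewrite scale0r.
(* [p] is the Radon point: a convex combination both of the [x i] with [c i > 0]
   and of those with [c i < 0]; one of the two avoids [x j]. *)
exists p => j; have [cj|cj] := ltP 0%R (c j).
- rewrite pN sN; apply: convex_set_sum => //.
  + by move=> i; rewrite oppr_gt0.
  + by move=> i ci; apply: Fne; apply: contraTneq ci => ->; rewrite -leNgt ltW.
  + by rewrite -sN.
- apply: convex_set_sum => // i ci.
  by apply: Fne; apply: contraTneq ci => ->; rewrite -leNgt.
Qed.

Lemma polyhedron_convex (R : realType) (n : nat)
    (U : set (convex_lmodType 'cV[R]_n)) :
  polyhedron U -> convex_set U.
Proof.
move=> [m [A [b ->]]]; apply/convex_setP => x y s t Ax Ay s0 t0 st1 i.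
have -> : ((A *m (s *: x + t *: y)) i 0 =
    s * (A *m x) i 0 + t * (A *m y) i 0)%R.
  by rewrite mulmxDr -!scalemxAr !mxE.
rewrite -[leRHS]mul1r -st1 mulrDl.
by rewrite lerD // ler_pM2l.
Qed.

Section FiniteAdaptability.

Variables (R : realType) (nxi ny : nat).
Variables (Y : {set 'cV[bool]_ny}) (U : set 'cV[R]_nxi).
Variables (C : 'M[R]_nxi) (P : 'M[R]_(nxi, ny)).

Lemma cost_comb (w : 'cV[bool]_nxi) (y : 'cV[bool]_ny) (a b : R)
    (x z : 'cV[R]_nxi) :
  (cost C P w y (a *: x + b *: z) = a * cost C P w y x + b * cost C P w y z)%R.
Proof.
rewrite /cost linearD /= !linearZ /= !mulmxDl -!scalemxAl !mxE.
by rewrite !mulrDr addrACA.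
Qed.

Lemma worst_cost_superlevel_convex (w : 'cV[bool]_nxi) (y : 'cV[bool]_ny)
    (theta : \bar R) :
  convex_set (U : set (convex_lmodType 'cV[R]_nxi)) ->
  convex_set [set xibar : convex_lmodType 'cV[R]_nxi |
    U xibar /\ (theta < worst_cost U C P w xibar y)%E].
Proof.
move=> /convex_setP cU; apply/convex_setP => x z a b.
move=> -[Ux /ereal_sup_gtP[_ [xi [Uxi xiE] <-] xi_gt]].
move=> -[Uz /ereal_sup_gtP[_ [ze [Uze zeE] <-] ze_gt]] a0 b0 ab1.
split; first exact: cU.
apply/ereal_sup_gtP; exists (cost C P w y (a *: xi + b *: ze)%R)%:E.
  exists (a *: xi + b *: ze)%R => //; split; first exact: cU.
  move=> i; have := xiE i; have := zeE i; rewrite !mxE => zi xii.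
  by rewrite !mulrDr !(mulrCA _ a) !(mulrCA _ b) zi xii.
set r := cost C P w y xi in xi_gt; set t := cost C P w y ze in ze_gt.
(* The smaller of the two witness costs still exceeds [theta] and bounds the combined cost from
   below. *)
have : (theta < (Num.min r t)%:E)%E by rewrite /Num.min; case: ifP.
move=> /lt_le_trans; apply; rewrite lee_fin cost_comb -/r -/t.
rewrite -[leLHS]mul1r -ab1 mulrDl.
by rewrite lerD // ler_pM2l // ge_min lexx ?orbT.
Qed.

(** Restricting the choice made after observation to [k] members of [Y] can only raise the inner
    minimum. *)
Lemma adaptive_le_kadapt (k : nat) (w : 'cV[bool]_nxi)
    (y : 'I_k -> 'cV[bool]_ny) :
  (forall i, y i \in Y) ->
  (adaptive_value Y U C P w <= kadapt_value U C P w y)%E.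
Proof.
move=> Yy; apply/ereal_supP => _ [xibar Uxibar <-].
apply: le_ereal_sup_tmp.
exists (\big[Order.min/+oo%E]_(i < k) worst_cost U C P w xibar (y i)).
  by exists xibar.
apply/bigmin_geP; split; first exact: leey.
by move=> i _; exact: bigmin_le_cond.
Qed.

Lemma kadapt_le_adaptive (w : 'cV[bool]_nxi) :
  Y <> finset.set0 -> convex_set (U : set (convex_lmodType 'cV[R]_nxi)) ->
  exists2 y : 'I_nxi.+1 -> 'cV[bool]_ny, (forall i, y i \in Y) &
    (kadapt_value U C P w y <= adaptive_value Y U C P w)%E.
Proof.
move=> /eqP/finset.set0Pn[y0 Yy0] cU; set theta := adaptive_value _ _ _ _ _.
(* Membership in [U] is part of [F i], so that a common point is an admissible scenario. *)
pose F (i : 'I_#|Y|) := [set xibar : convex_lmodType 'cV[R]_nxi |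
  U xibar /\ (theta < worst_cost U C P w xibar (enum_val i))%E]%classic.
have noF : ~ exists x, forall i, F i x.
  move=> [x Fx]; have [Ux _] := Fx (enum_rank_in Yy0 y0).
  have : (\big[Order.min/+oo]_(y in Y) worst_cost U C P w x y <= theta)%E.
    by apply: ereal_sup_ubound; exists x.
  rewrite leNgt => /negP; apply; apply/bigmin_gtP; split.
    (* The default value [+oo] of the minimum must exceed [theta] as well; the excess under [y0]
       ensures it. *)
    by have [_ /lt_le_trans] := Fx (enum_rank_in Yy0 y0); apply; exact: leey.
  by move=> y Yy; have [_] := Fx (enum_rank_in Yy0 y); rewrite enum_rankK_in.
(* Either some [nxi.+1] indices have no common scenario, and they give the policies, or Helly
   contradicts [noF]. *)
have [[f Ff]|nof] := pselect (exists f : 'I_nxi.+1 -> 'I_#|Y|,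
  ~ exists x, forall i, F (f i) x); last first.
  case: noF; apply: helly => [i|f].
    exact: worst_cost_superlevel_convex.
  by apply: contrapT => nf; apply: nof; exists f.
exists (fun i => enum_val (f i)); first by move=> i; exact: enum_valP.
apply/ereal_supP => _ [x Ux <-]; rewrite leNgt; apply/negP => /bigmin_gtP[_ gt].
by apply: Ff; exists x => i; split => //; exact: gt.
Qed.

End FiniteAdaptability.

Theorem mainTheorem2 (R : realType) (nxi ny : nat)
    (W : {set 'cV[bool]_nxi}) (Y : {set 'cV[bool]_ny})
    (U : set 'cV[R]_nxi) (C : 'M[R]_nxi) (P : 'M[R]_(nxi, ny))
    (W_neq0 : W <> finset.set0) (Y_neq0 : Y <> finset.set0)
    (U_neq0 : nonempty U) (U_compact : compact U) (U_poly : polyhedron U)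
    (w : 'cV[bool]_nxi) :
  kadapt_optimal W Y U C P nxi.+1 w <-> optimal W Y U C P w.
Proof.
have policies := kadapt_le_adaptive C P _ Y_neq0 (polyhedron_convex U_poly).
(* For each decision the least [kadapt_value] over policies in [Y] equals [adaptive_value]. The
   Helly policies are taken at the competitor [w'] in one direction and at [w] in the other. *)
split=> [[Ww [y [Yy y_opt]]]|[Ww w_opt]]; split => //.
- move=> w' Ww'; have [y' Yy' le_y'] := policies w'.
  apply: le_trans (adaptive_le_kadapt U C P w Yy) _.
  exact: le_trans (y_opt _ _ Ww' Yy') le_y'.
- have [y Yy le_y] := policies w; exists y; split => // w' y' Ww' Yy'.
  apply: le_trans le_y (le_trans (w_opt _ Ww') _).
  exact: adaptive_le_kadapt.
Qed.
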